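(* Let $X$ be a strongly $0$-dimensional metrizable space with $\operatorname{card}(X)\le\mathfrak{c}$. Then for every $d\in\mathrm{Met}(X)$ and every $\epsilon\in(0,\infty)$ there exists $e\in\mathrm{LI}(X)$ with $\mathcal{D}_X(d,e)\le\epsilon$; that is, $\mathrm{LI}(X)$ is dense in $(\mathrm{Met}(X),\mathcal{D}_X)$. Moreover, if $X$ is completely metrizable, then $e$ can be chosen to be a complete metric.
   Context: For a topological space $X$ and $S\subseteq[0,\infty)$ with $0\in S$, $\mathrm{Met}(X;S)$ denotes the set of all metrics on $X$ taking values in $S$ and generating the topology of $X$; $\mathrm{Met}(X)=\mathrm{Met}(X;[0,\infty))$. The supremum metric on $\mathrm{Met}(X)$ is $\mathcal{D}_X(d,e)=\sup_{x,y\in X}|d(x,y)-e(x,y)|$ (a metric with values in $[0,\infty]$), and $\mathrm{Met}(X)$ carries the topology generated by its open balls. $\mathfrak{c}$ is the cardinality of the continuum. A topological space is strongly $0$-dimensional if for every pair $A,B$ of disjoint closed subsets there is a clopen set $V$ with $A\subseteq V$ and $V\cap B=\emptyset$. $\mathrm{LI}(X)$ is the set of all $d\in\mathrm{Met}(X)$ such that whenever $x,y,u,v\in X$ satisfy $x\neq y$, $u\neq v$ and $\{x,y\}\neq\{u,v\}$, the two reals $d(x,y)$ and $d(u,v)$ are linearly independent over $\mathbb{Q}$. *)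

(* Defs.v *)
From HB Require Import structures.
From mathcomp Require Import all_boot all_order all_algebra.
From mathcomp Require Import all_classical all_reals topology.
Set Implicit Arguments. Unset Strict Implicit. Unset Printing Implicit Defensive.
Import Order.TTheory GRing.Theory Num.Theory.
Local Open Scope ring_scope.
Local Open Scope classical_set_scope.

Section Defs.
Context {R : realType} {X : topologicalType}.

Definition is_metric (d : X -> X -> R) : Prop :=
  (forall x y, 0 <= d x y) /\
  (forall x y, d x y = 0 <-> x = y) /\
  (forall x y, d x y = d y x) /\
  (forall x y z, d x z <= d x y + d y z).

Definition generates_topology (d : X -> X -> R) : Prop :=
  forall A : set X, open A <->
    (forall x, A x -> exists r : R, 0 < r /\ [set y | d x y < r] `<=` A).

Definition Met (d : X -> X -> R) : Prop := is_metric d /\ generates_topology d.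

Definition complete_metric (d : X -> X -> R) : Prop :=
  forall u : nat -> X,
    (forall eps : R, 0 < eps -> exists N : nat,
        forall m n : nat, (N <= m)%N -> (N <= n)%N -> d (u m) (u n) < eps) ->
    exists x : X, forall eps : R, 0 < eps -> exists N : nat,
        forall n : nat, (N <= n)%N -> d (u n) x < eps.

Definition metrizable : Prop := exists d : X -> X -> R, Met d.

Definition completely_metrizable : Prop :=
  exists d : X -> X -> R, Met d /\ complete_metric d.

Definition strongly_zero_dim : Prop :=
  forall A B : set X, closed A -> closed B -> A `&` B = set0 ->
    exists V : set X, open V /\ closed V /\ A `<=` V /\ V `&` B = set0.

(* card X <= c  (c = card R, R being a complete archimedean ordered field) *)
Definition card_le_continuum : Prop := exists f : X -> R, injective f.

Definition Q_lin_indep (a b : R) : Prop :=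
  forall p q : rat, ratr p * a + ratr q * b = 0 -> p = 0 /\ q = 0.

Definition LI (d : X -> X -> R) : Prop :=
  Met d /\
  forall x y u v : X, x <> y -> u <> v ->
    ~ ((x = u /\ y = v) \/ (x = v /\ y = u)) ->
    Q_lin_indep (d x y) (d u v).

Definition sup_dist_le (d e : X -> X -> R) (eps : R) : Prop :=
  forall x y : X, `|d x y - e x y| <= eps.

End Defs.

(* Main.v *)
Require Import Defs.
From mathcomp Require Import all_boot all_order all_algebra.
From mathcomp Require Import all_classical all_reals topology wochoice.
From mathcomp Require Import zify ring lra.
Import Order.TTheory GRing.Theory Num.Theory.
Local Open Scope ring_scope.

(* Strong zero-dimensionality makes X ultraparacompact, so the identity of X is
   a uniform limit of locally constant maps rho_n.  The first index at which
   {0} U {2^-n}, and, as card X <= c, these maps also give each point x a set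
   A_x of naturals, infinite and almost disjoint from the other A_y, hence a
   real psi_x = sum_{k in A_x} 1/k!.  Any finitely many psi_x are linearly
   independent over Q together with 1, and |psi_x - psi_y| <= 2 u(x,y).  With q0
   a rational-valued rounding of d(rho_0 x, rho_0 y) and eta a small rational,
     e(x,y) = q0(x,y) + eta u(x,y) ((1 + psi_x) + (1 + psi_y))
   is a metric: the Lipschitz bound on psi is absorbed by the strong triangle
   inequality of u.  A rational relation between e(x,y) and e(u,v) is a relation
   between the psi's and 1 in which psi_x has coefficient p eta u(x,y).
   Taking the rho_n close to the identity for the sum of d and a complete
   metric makes e-Cauchy sequences Cauchy for the complete metric. *)

(** * Reciprocal factorial sums *)

Definition sumfact (R : realType) (A : pred nat) (m : nat) : R :=
  \sum_(0 <= k < m | A k) (k`!%:R)^-1.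

(* The sum of [1/k!] over the [k] in [A], as the supremum of its partial sums. *)
Definition recfact (R : realType) (A : pred nat) : R := sup (range (sumfact R A)).

(** The constant 2 closes the induction: after peeling off the first term and factoring out
    [1/(m.+1)!], what is needed is [1 + 2 / m.+2 <= 2]. *)
Lemma fact_tail_le (R : realType) (m n : nat) :
  \sum_(m.+1 <= k < m.+1 + n) (k`!%:R)^-1 <= 2 / (m.+1)`!%:R :> R.
Proof.
elim: n m => [|n IH] m.
  by rewrite addn0 big_geq // divr_ge0 ?ler0n.
rewrite big_ltn ?addnS ?ltnS ?leq_addr //.
apply: (le_trans (lerD (lexx _) (IH m.+1))).
have f0 : (0 : R) < (m.+1)`!%:R by rewrite ltr0n fact_gt0.
have -> : 2 / (m.+2)`!%:R = (2 / m.+2%:R) * ((m.+1)`!%:R)^-1 :> R.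
  by rewrite (factS m.+1) natrM invfM mulrA.
rewrite -[X in X + _]mul1r -mulrDl ler_pM2r ?invr_gt0 // -lerBrDl.
rewrite ler_pdivrMr ?ltr0n //; have := ler_nat R 2 m.+2; rewrite !ltnS leq0n; lra.
Qed.

Lemma sumfact_tail (R : realType) (A : pred nat) (m n : nat) :
  sumfact R A m.+1 <= sumfact R A (m.+1 + n) <= sumfact R A m.+1 + 2 / (m.+1)`!%:R.
Proof.
rewrite /sumfact (@big_cat_nat _ _ _ m.+1 0 (m.+1 + n)%N) ?leq_addr //=.
rewrite lerDl sumr_ge0 /= => [|k _]; last by rewrite invr_ge0 ler0n.
rewrite lerD2l (le_trans _ (fact_tail_le R m n)) //.
rewrite big_mkcond /= ler_sum // => k _.
by case: ifP => // _; rewrite invr_ge0 ler0n.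
Qed.

Lemma recfact_bounds (R : realType) (A : pred nat) (m : nat) :
  sumfact R A m.+1 <= recfact R A <= sumfact R A m.+1 + 2 / (m.+1)`!%:R.
Proof.
have ub n : sumfact R A n <= sumfact R A m.+1 + 2 / (m.+1)`!%:R.
  have [nm|mn] := leqP m.+1 n.
    by have /andP[_] := sumfact_tail R A m (n - m.+1); rewrite subnKC.
  apply: (@le_trans _ _ (sumfact R A m.+1)).
    rewrite /sumfact (@big_cat_nat _ _ _ n 0 m.+1) ?(ltnW mn) //=.
    by rewrite lerDl sumr_ge0 // => k _; rewrite invr_ge0 ler0n.
  by rewrite lerDl divr_ge0 ?ler0n.
apply/andP; split.
  apply: sup_upper_bound; last by exists m.+1.
  split; first by exists (sumfact R A 0), 0%N.
  by exists (sumfact R A m.+1 + 2 / (m.+1)`!%:R) => _ [n _ <-].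
by apply: ge_sup; [exists (sumfact R A 0), 0%N|move=> _ [n _ <-]].
Qed.

Lemma recfact_ge0 (R : realType) (A : pred nat) : 0 <= recfact R A.
Proof.
have /andP[+ _] := recfact_bounds R A 0; apply: le_trans.
by rewrite /sumfact sumr_ge0 // => k _; rewrite invr_ge0 ler0n.
Qed.

Lemma recfact_le3 (R : realType) (A : pred nat) : recfact R A <= 3.
Proof.
have /andP[_ /le_trans] := recfact_bounds R A 0; apply.
rewrite /sumfact big_mkcond /= big_nat1 !factE !invr1; case: ifP => _; lra.
Qed.

(** The common partial sum puts both values in one interval of length [2 / (m.+1)!]. *)
Lemma recfact_dist (R : realType) (A B : pred nat) (m : nat) :
  (forall k, (k <= m)%N -> A k = B k) ->
  `|recfact R A - recfact R B| <= 2 / (m.+1)`!%:R.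
Proof.
move=> AB; have E : sumfact R A m.+1 = sumfact R B m.+1.
  by rewrite /sumfact; apply: congr_big_nat.
have /andP[a1 a2] := recfact_bounds R A m.
have /andP[b1 b2] := recfact_bounds R B m.
move: a1 a2; rewrite E => a1 a2; rewrite ler_norml; apply/andP; split; lra.
Qed.

Lemma sumfact_int (R : realType) (A : pred nat) (j : nat) :
  exists z : int, j`!%:R * sumfact R A j.+1 = z%:~R.
Proof.
exists (\sum_(0 <= k < j.+1 | A k) Posz (j`! %/ k`!)).
rewrite /sumfact mulr_sumr rmorph_sum /= big_nat_cond [RHS]big_nat_cond.
apply: eq_bigr => k /andP[/andP[_ kj] _]; rewrite ltnS in kj.
have kd : (k`! %| j`!)%N.
  by rewrite (fact_split kj) dvdn_mulr.
apply: (@mulIf _ (k`!%:R)); first by rewrite pnatr_eq0 -lt0n fact_gt0.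
rewrite mulfVK ?pnatr_eq0 -?lt0n ?fact_gt0 //.
by rewrite -{1}(divnK kd) natrM.
Qed.

(* Scaling by [j!] makes every term of index [<= j] an integer, while the terms
   of index [> j.+1] contribute [O(1/j^2)]. *)
Lemma recfact_split (R : realType) (A : pred nat) (j : nat) :
  exists (z : int) (t : R), 0 <= t <= 2 / j.+2%:R /\
    (j.+1)`!%:R * recfact R A = j.+1%:R * z%:~R + (A j.+1)%:R + t.
Proof.
have [z zE] := sumfact_int R A j.
exists z, ((j.+1)`!%:R * (recfact R A - sumfact R A j.+2)); split.
  have /andP[a1 a2] := recfact_bounds R A j.+1.
  have f0 : (0 : R) < (j.+1)`!%:R by rewrite ltr0n fact_gt0.
  apply/andP; split; first by rewrite mulr_ge0 ?subr_ge0 // ltW.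
  rewrite mulrC -ler_pdivlMr // -mulrA -invfM -natrM -factS; lra.
have -> : sumfact R A j.+2 = sumfact R A j.+1 + (A j.+1)%:R / (j.+1)`!%:R.
  rewrite /sumfact [LHS]big_mkcond big_nat_recr //= -big_mkcond /=.
  by case: (A j.+1); rewrite ?mul1r ?mul0r.
have f0 : (j.+1)`!%:R != 0 :> R by rewrite pnatr_eq0 -lt0n fact_gt0.
rewrite -zE mulrA -natrM -factS; field; exact: f0.
Qed.

(** As in the irrationality proof for Euler's number, multiply by [(j.+1)!], with [j.+1] large, in
    [A] and in none of the other sets. Modulo [j.+1] only [p] and a small error survive. *)
Lemma recfact_indep (R : realType) (A : pred nat) (p r : int)
    (s : seq (int * pred nat)) :
  (forall N, exists k, [/\ (N <= k)%N, A k & forall q, q \in [seq x.2 k | x <- s] -> ~~ q]) ->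
  p%:~R * recfact R A + \sum_(x <- s) x.1%:~R * recfact R x.2 = r%:~R -> p = 0.
Proof.
move=> freq E.
pose C : nat := (`|p| + \sum_(x <- s) `|x.1|)%N.
(* This threshold ensures [2 * C < j.+2], so that the error stays below 1, and [|p| <= j]. *)
have [[//|j] [jN Aj sj]] := freq (2 * C + 2)%N.
  by move: jN; rewrite addn2.
have : exists (z : int) (t : R), `|t| <= (\sum_(x <- s) `|x.1|)%:R * (2 / j.+2%:R)
   /\ (j.+1)`!%:R * (\sum_(x <- s) x.1%:~R * recfact R x.2) = j.+1%:R * z%:~R + t.
  elim: s sj {freq E C jN} => [|[c B] s IH] sj.
    by exists 0, 0; rewrite !big_nil normr0 !mulr0 addr0 mul0r.
  have [|z [t [tb tE]]] := IH; first by move=> q qs; apply: sj; rewrite inE qs orbT.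
  have [z' [t' [/andP[t0 t1] tE']]] := recfact_split R B j.
  have /negbTE B0 : ~~ B j.+1 by apply: sj; rewrite inE eqxx.
  exists (c * z' + z), (c%:~R * t' + t); split.
    rewrite !big_cons natrD mulrDl (le_trans (ler_normD _ _)) // lerD // normrM.
    rewrite (ger0_norm t0) -intr_norm natr_absz ler_wpM2l //.
  rewrite !big_cons /= mulrDr tE mulrCA tE' B0 addr0 rmorphD rmorphM /=; ring.
move=> [z [t [tb tE]]].
have [z' [t' [/andP[t0 t1] tE']]] := recfact_split R A j.
rewrite Aj /= in tE'.
have key : p%:~R + (p%:~R * t' + t) = j.+1%:R * (j`!%:R * r%:~R - p%:~R * z' %:~R - z%:~R) :> R.
  move/(congr1 (fun v => (j.+1)`!%:R * v)): E.
  rewrite mulrDr tE mulrCA tE' factS natrM /= => E'.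
  have -> : j.+1%:R * (j`!%:R * r%:~R - p%:~R * z'%:~R - z%:~R) =
    j.+1%:R * j`!%:R * r%:~R - j.+1%:R * p%:~R * z'%:~R - j.+1%:R * z%:~R :> R by ring.
  rewrite -E'; ring.
have small : `|p%:~R * t' + t| < 1.
  apply: (@le_lt_trans _ _ (C%:R * (2 / j.+2%:R))).
    rewrite (le_trans (ler_normD _ _)) // natrD mulrDl lerD // normrM.
    by rewrite (ger0_norm t0) -intr_norm natr_absz ler_wpM2l.
  rewrite mulrA ltr_pdivrMr ?ltr0n // mul1r -natrM ltr_nat; lia.
pose M : int := Posz (j`!) * r - p * z' - z.
have ME : p%:~R + (p%:~R * t' + t) = j.+1%:R * M%:~R :> R.
  by rewrite key /M !rmorphB !rmorphM.
(* A nonzero multiple of [j.+1] is at least [j.+1] in size, but the left side is below [|p| + 1]. *)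
have M0 : M = 0.
  apply/eqP; apply: contraTT isT => M0 /=.
  have : (j.+1%:R : R) < j.+1%:R.
    apply: (@le_lt_trans _ _ `|p%:~R + (p%:~R * t' + t)|).
      rewrite ME normrM ger0_norm // ler_peMr // -intr_norm (ler_int _ 1).
      by rewrite -gtz0_ge1 normr_gt0.
    apply: (le_lt_trans (ler_normD _ _)).
    apply: (@lt_le_trans _ _ (`|p|%N%:R + 1)).
      by rewrite -intr_norm natr_absz ltrD2l.
    rewrite -natr1 lerD2r ler_nat; lia.
  by rewrite ltxx.
rewrite M0 mulr0 in ME.
have : `|p%:~R : R| < 1.
  have -> : p%:~R = - (p%:~R * t' + t) :> R by lra.
  by rewrite normrN.
rewrite -intr_norm (ltr_int _ _ 1); lia.
Qed.

(** * Ultraparacompactness *)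

Lemma metric_ball_open {R : realType} {X : topologicalType} (D : X -> X -> R) (x : X) (r : R) :
  Met D -> open [set y | D x y < r]%classic.
Proof.
move=> [[_ [_ [_ tri]]] gen]; apply/gen => y /= xy.
exists (r - D x y); split; first by rewrite subr_gt0.
by move=> z /= yz; have := tri x y z; lra.
Qed.

Lemma common_radius {R : realType} {X : Type} (D : X -> X -> R) (x : X)
    (P : nat -> X -> Prop) (n : nat) :
  (forall m, (m < n)%N -> exists s, 0 < s /\ forall y, D x y < s -> P m y) ->
  exists s, 0 < s /\ forall y, D x y < s -> forall m, (m < n)%N -> P m y.
Proof.
elim: n => [|n IH] H; first by exists 1; split.
have [|s [s0 sP]] := IH; first by move=> m mn; apply: H; rewrite ltnS ltnW.
have [t [t0 tP]] := H n (ltnSn n).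
exists (Num.min s t); rewrite lt_min s0 t0; split=> // y.
rewrite lt_min => /andP[ys yt] m; rewrite ltnS leq_eqVlt => /orP[/eqP->|mn].
  exact: tP.
exact: sP.
Qed.

Lemma well_ordered_type (X : eqType) : exists W : rel X,
  [/\ antisymmetric W, total W &
      forall P : pred X, (exists x, P x) -> exists2 a, P a & forall b, P b -> W a b].
Proof.
have [W Wwo] := well_ordering_principle X.
have wo : wo_chain W predT by move=> A _; apply: Wwo.
exists W; split=> [a b ab|a b|P [x Px]].
- exact: (wo_chain_antisymmetric wo).
- exact: (wo_chainW wo).
- have [|a [[aP amin] _]] := Wwo P; first by exists x.
  by exists a => // b bP; apply: amin.
Qed.

(* Stone's argument: assign to [x] the least centre [al x] within [r] of [x].
   The points with [D x (al x) + g k <= r] fall, according to [al], into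
   [g k]-separated layers; a clopen set [V k] between such a union of layers and
   its neighbourhood [O k] splits into clopen pieces, and [x] goes to the piece
   of the first [V k] containing it. *)
Lemma locally_constant_approx {R : realType} {X : topologicalType} (D : X -> X -> R) (r : R) :
  @strongly_zero_dim X -> Met D -> 0 < r ->
  exists rho : X -> X,
    (forall x, exists s, 0 < s /\ forall y, D x y < s -> rho y = rho x) /\
    (forall x, D x (rho x) < r).
Proof.
move=> dim0 MD r0.
have [[_ [D0 [Dsym tri]]] gen] := MD.
have Dxx x : D x x = 0 by apply/D0.
have [W [Wanti Wtot Wmin]] := well_ordered_type X.
have /choice[al alP] : forall x, exists a, D x a < r /\ forall b, D x b < r -> W a b.
  move=> x; have [|a ax amin] := Wmin [pred a | D x a < r].
    by exists x; rewrite /= Dxx.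
  by exists a; split.
have [g g0 gP] : exists2 g : nat -> R, forall k, 0 < g k & forall a, a < r -> exists k, a + g k < r.
  exists (fun k => k.+1%:R^-1) => [k|a]; first by rewrite invr_gt0 ltr0n.
  exact: ltr_add_invr.
pose A k := [set x | D x (al x) + g k <= r]%classic.
(* The slack [g k] puts [al x] within [r] of [y], so minimality of [al y] compares the two
   centres. *)
have sep k x y : A k x -> A k y -> D x y < g k -> al x = al y.
  wlog le : x y / W (al x) (al y).
    move=> H; have /orP[le|le] := Wtot (al x) (al y); first exact: H.
    by move=> Ax Ay xy; apply/esym/H => //; rewrite Dsym.
  rewrite /A /= => Ax Ay xy; apply: Wanti; rewrite le /=; apply: (alP y).2.
  by have := tri y x (al x); rewrite (Dsym y x); lra.
(* Half the separation [g k] keeps the pieces of distinct centres disjoint. *)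
pose O k a := [set z | exists x, [/\ A k x, al x = a & D x z < g k / 2]]%classic.
have Oopen k a : open (O k a).
  apply/gen => z [x [Ax xa xz]]; have /gen/(_ z xz)[s [s0 sP]] := metric_ball_open D x (g k / 2) MD.
  by exists s; split=> // y zy; exists x; split=> //; apply: sP.
have Odisj k a b z : O k a z -> O k b z -> a = b.
  move=> [x [Ax <- xz]] [y [Ay <- yz]]; apply: (sep k) => //.
  by have := tri x z y; rewrite (Dsym z y); lra.
have Onear k a z : O k a z -> D z a < r.
  move=> [x [Ax <- xz]]; have := tri z x (al x); rewrite (Dsym z x).
  by move: Ax (g0 k); rewrite /A /=; lra.
have /choice[V VP] : forall k, exists V, [/\ open V, closed V, (A k `<=` V)%classic &
    (V `<=` [set z | exists a, O k a z])%classic].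
  move=> k; have Uopen : open [set z | exists a, O k a z]%classic.
    apply/gen => z [a /(proj1 (gen _) (Oopen k a) z)[s [s0 sP]]].
    by exists s; split=> // y /sP Oy; exists a.
  (* [A k] need not be closed, but its closure stays in the union of the pieces, as the radius
     [g k / 2] is uniform. *)
  have [| | |V [Vo [Vc [AV VU]]]] := dim0 (closure (A k)) (~` [set z | exists a, O k a z])%classic.
  - exact: closed_closure.
  - exact: open_closedC.
  - rewrite -subset0 => z [Az]; apply => /=.
    have [|x [Ax zx]] := Az [set y | D z y < g k / 2]%classic.
      by apply: open_nbhs_nbhs; split; [exact: metric_ball_open|rewrite /= Dxx divr_gt0].
    by exists (al x), x; split=> //; rewrite Dsym.
  exists V; split=> //; first by apply: (subset_trans _ AV); exact: subset_closure.
  by move=> z Vz; apply: contrapT => nU; rewrite -[False]/(set0 z) -VU.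
have /choice[N NP] : forall x, exists n, V n x /\ forall m, (m < n)%N -> ~ V m x.
  move=> x; have ex : exists n, `[< V n x >].
    have [k kP] := gP _ (alP x).1.
    by exists k; apply/asboolP; have [_ _ AV _] := VP k; apply: AV; exact: ltW.
  case: (ex_minnP ex) => n /asboolP Vn nmin; exists n; split=> // m mn Vm.
  by have := nmin m (asboolT Vm); rewrite leqNgt mn.
have /choice[rho rhoP] : forall x, exists a, O (N x) a x.
  by move=> x; have [_ _ _ VO] := VP (N x); apply: VO; exact: (NP x).1.
exists rho; split=> [x|x]; last exact: Onear (rhoP x).
have [Vo _ _ _] := VP (N x).
have [s [s0 sP]] := proj1 (gen _) Vo x (NP x).1.
have [t [t0 tP]] := proj1 (gen _) (Oopen _ _) x (rhoP x).
(* Only finitely many closed sets precede [V (N x)], so a ball around [x] avoids them all and [N] is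
   constant near [x]. *)
have [|w [w0 wP]] := @common_radius R X D x (fun m y => ~ V m y) (N x).
  move=> m mN; have [_ Vc _ _] := VP m.
  have [w [w0 wP]] := proj1 (gen _) (closed_openC Vc) x ((NP x).2 m mN).
  by exists w; split.
exists (Num.min s (Num.min t w)); rewrite !lt_min s0 t0 w0; split=> // y.
rewrite !lt_min => /and3P[ys yt yw].
have Vy : V (N x) y := sP y ys.
have Oy : O (N x) (rho x) y := tP y yt.
have nVy : forall m, (m < N x)%N -> ~ V m y := wP y yw.
have NE : N y = N x.
  have [lt|lt|//] := ltngtP (N y) (N x).
    by case: (nVy _ lt (NP y).1).
  by case: ((NP y).2 _ lt Vy).
have Oy' : O (N x) (rho y) y by rewrite -NE; exact: rhoP.
exact: Odisj Oy' Oy.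
Qed.

(** * Ultrametrics and codes from sequences of partitions *)

Definition agree {X Y : Type} (rho : nat -> X -> Y) (n : nat) (x y : X) : Prop :=
  forall i, (i < n)%N -> rho i x = rho i y.

Lemma agree_le {X Y : Type} (rho : nat -> X -> Y) (m n : nat) (x y : X) :
  (m <= n)%N -> agree rho n x y -> agree rho m x y.
Proof. by move=> mn xy i im; apply: xy; apply: leq_trans mn. Qed.

(** Take [2 ^- n] for the first [n] at which [rho n] separates the points. Values are rational
    because they will be coefficients in relations over the rationals. *)
Lemma ultrametric_of_levels {X Y : Type} (rho : nat -> X -> Y) :
  (forall x y, (forall n, rho n x = rho n y) -> x = y) ->
  exists u : X -> X -> rat,
    [/\ forall x y, u x y = 0 <-> x = y,
        forall x y, u x y = u y x,
        forall x y z, u x z <= Num.max (u x y) (u y z),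
        forall x y, u x y = 0 \/ exists n, u x y = 2 ^- n &
        forall n x y, u x y <= 2 ^- n <-> agree rho n x y].
Proof.
move=> sep.
have p2 (n : nat) : 0 < 2 ^- n :> rat by rewrite invr_gt0 exprn_gt0.
have p2le (m n : nat) : (2 ^- m <= 2 ^- n :> rat) = (n <= m)%N.
  by rewrite lef_pV2 ?posrE ?exprn_gt0 // ler_eXn2l.
have /choice[w wP] : forall z : X * X, exists v : rat,
    (z.1 = z.2 /\ v = 0) \/
    (z.1 <> z.2 /\
     exists n, [/\ v = 2 ^- n, agree rho n z.1 z.2 & rho n z.1 <> rho n z.2]).
  move=> [x y] /=.
  have [xy|xy] := pselect (x = y); first by exists 0; left.
  have ex : exists n, `[< rho n x <> rho n y >].
    apply: contrapT => nex; apply: xy; apply: sep => n.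
    by apply: contrapT => nE; apply: nex; exists n; apply/asboolP.
  case: (ex_minnP ex) => n /asboolP nE nmin.
  exists (2 ^- n); right; split=> //; exists n; split=> // i im.
  by apply: contrapT => /asboolP /nmin; rewrite leqNgt im.
pose u x y := w (x, y).
have uP x y : (x = y /\ u x y = 0) \/
    (x <> y /\ exists n, [/\ u x y = 2 ^- n, agree rho n x y & rho n x <> rho n y]).
  exact: wP (x, y).
have lev n x y : u x y <= 2 ^- n <-> agree rho n x y.
  have [[<- ->]|[xy [m [-> am nm]]]] := uP x y.
    by split=> // _; exact: ltW.
  rewrite p2le; split=> [nlem|an]; first exact: agree_le am.
  by rewrite leqNgt; apply/negP => /an.
have val x y : u x y = 0 \/ exists n, u x y = 2 ^- n.
  have [[_ ->]|[xy [m [-> _ _]]]] := uP x y; first by left.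
  by right; exists m.
have u0 x y : u x y = 0 <-> x = y.
  have [[-> ->]|[xy [m [E _ _]]]] := uP x y; first by [].
  by split=> // E0; have := p2 m; rewrite -E E0 ltxx.
have agree_sym n x y : agree rho n x y -> agree rho n y x.
  by move=> xy i im; rewrite xy.
have ule x y : u x y <= u y x.
  have [E|[n E]] := val y x; last by rewrite E; apply/lev/agree_sym/lev; rewrite E.
  by move: (E) => /u0 ->; rewrite lexx.
exists u; split=> // [x y|x y z].
  by apply/eqP; rewrite eq_le !ule.
have [E|[n E]] : Num.max (u x y) (u y z) = 0 \/ exists n, Num.max (u x y) (u y z) = 2 ^- n.
  by rewrite maxEle; case: ifP => _; exact: val.
  have ge0 a b : 0 <= u a b by have [->|[n ->]] := val a b; rewrite // ltW.
  have xy : u x y = 0 by apply/eqP; rewrite eq_le ge0 -E le_max lexx.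
  have yz : u y z = 0 by apply/eqP; rewrite eq_le ge0 -E le_max lexx orbT.
  move: yz xy E => /u0 -> /u0 -> ->.
  by have /u0 -> : z = z.
rewrite E; apply/lev => i im.
have xy : agree rho n x y by apply/lev; rewrite -E le_max lexx.
have yz : agree rho n y z by apply/lev; rewrite -E le_max lexx orbT.
by rewrite xy // yz.
Qed.

(* The bit is [false] at indices that encode no rational. *)
Definition cut_bit {R : realType} (t : R) (j : nat) : bool :=
  if @unpickle rat j is Some q then ratr q < t else false.

Lemma cut_bit_inj {R : realType} (s t : R) :
  (forall j, cut_bit s j = cut_bit t j) -> s = t.
Proof.
have lt_neq (a b : R) : a < b -> exists j, cut_bit a j <> cut_bit b j.
  move=> /rat_in_itvoo[q]; rewrite in_itv /= => /andP[aq qb].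
  by exists (pickle q); rewrite /cut_bit pickleK qb ltNge ltW.
move=> E; apply/eqP; apply: contraPT E; rewrite neq_lt => /orP[] /lt_neq[j jE] E.
  by apply: jE.
by apply: jE; rewrite E.
Qed.

(** The code at level [n] records the first [n] cut bits of the first [n] values [f (rho i x)];
    distinct points get almost disjoint sets of codes. *)
Lemma prefix_codes {R : realType} {X Y : Type} (rho : nat -> X -> Y) (f : Y -> R) :
  injective f -> (forall x y, (forall n, rho n x = rho n y) -> x = y) ->
  exists c : nat -> X -> nat,
    [/\ forall n x, (n < c n x)%N,
        forall n x y, agree rho n x y -> c n x = c n y &
        forall x y, x <> y -> exists N, forall n m, (N <= n)%N -> c n x <> c m y].
Proof.
move=> finj sep.
pose s n x := [seq [seq cut_bit (f (rho i x)) j | j <- iota 0 n] | i <- iota 0 n].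
(* The factor [2 ^ n] makes the level [n] readable off the code. *)
pose c n x := (2 ^ n * (pickle (s n x)).*2.+1)%N.
have logc n x : logn 2 (c n x) = n.
  rewrite /c lognM ?expn_gt0 // lognX logn_prime // eqxx muln1.
  by rewrite lognE dvdn2 /= odd_double /= addn0.
exists c; split=> [n x|n x y xy|x y xy].
- by apply: (leq_trans (ltn_expl n (ltnSn 1))); rewrite leq_pmulr.
- rewrite /c; congr (_ * (pickle _).*2.+1)%N; apply/eq_in_map => i.
  by rewrite mem_iota => /andP[_ im]; rewrite xy.
- have [i iE] : exists i, rho i x <> rho i y.
    by apply: contrapT => nex; apply/xy/sep => i; apply: contrapT => nE; apply: nex; exists i.
  have [j jE] : exists j, cut_bit (f (rho i x)) j <> cut_bit (f (rho i y)) j.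
    apply: contrapT => nex; apply: iE; apply/finj/cut_bit_inj => j.
    by apply: contrapT => nE; apply: nex; exists j.
  (* From this level on the table contains the entry [(i, j)], where the bits differ. *)
  exists (maxn i j).+1 => n m; rewrite gtn_max => /andP[im jm] cE.
  have nm : n = m by rewrite -(logc n x) cE logc.
  move: cE; rewrite -nm /c => /eqP; rewrite eqn_pmul2l ?expn_gt0 // eqSS.
  move=> /eqP/double_inj/(pcan_inj pickleK) sE.
  apply: jE.
  have /(congr1 (fun t => nth false (nth [::] t i) j)) := sE.
  by rewrite /s !(nth_map 0%N) ?size_iota // !nth_iota ?add0n.
Qed.

(** Here [psi x] is the reciprocal factorial sum over the codes of [x]. A code [k <= n] has level
    below [n], so points agreeing up to [n] share it. *)
Lemma independent_lipschitz {R : realType} {X Y : Type} (rho : nat -> X -> Y) (f : Y -> R) :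
  injective f -> (forall x y, (forall n, rho n x = rho n y) -> x = y) ->
  exists psi : X -> R,
    [/\ forall x, 0 <= psi x <= 3,
        forall n x y, agree rho n x y -> `|psi x - psi y| <= 2 * 2 ^- n &
        forall x y u v (p q r : rat), x <> y -> x <> u -> x <> v ->
          ratr p * (psi x + psi y) + ratr q * (psi u + psi v) = ratr r -> p = 0].
Proof.
move=> finj sep; have [c [cgt cagree csep]] := prefix_codes rho f finj sep.
pose A x : pred nat := fun k => `[< exists n, c n x = k >].
exists (fun x => recfact R (A x)); split=> [x|n x y xy|x y u v p q r xy xu xv E].
- by rewrite recfact_ge0 recfact_le3.
- have sub a b k : agree rho n a b -> (k <= n)%N -> A a k -> A b k.
    move=> ab kn /asboolP[m mE]; apply/asboolP; exists m; rewrite -mE.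
    apply/esym/cagree; apply: (agree_le _ _ n) => //.
    by apply: leq_trans kn; rewrite -mE ltnW.
  apply: (le_trans (recfact_dist R _ _ n _)) => [k kn|].
    by apply/idP/idP; apply: sub => // i im; rewrite xy.
  rewrite ler_pM2l // lef_pV2 ?posrE ?exprn_gt0 ?ltr0n ?fact_gt0 // -natrX ler_nat.
  elim: n {xy sub} => // n IH; rewrite expnS factS leq_mul //.
- have den (a : rat) : (denq a)%:~R * ratr a = (numq a)%:~R :> R.
    rewrite /ratr mulrCA divff ?mulr1 //.
    by rewrite intr_eq0 denq_neq0.
  (* Integer coefficients after multiplying the relation by all three denominators. *)
  pose P := numq p * denq q * denq r; pose Q := numq q * denq p * denq r.
  have : P = 0.
    apply: (@recfact_indep R (A x) P (numq r * denq p * denq q)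
        [:: (P, A y); (Q, A u); (Q, A v)]).
      move=> N; have [Ny yP] := csep x y xy; have [Nu uP] := csep x u xu.
      have [Nv vP] := csep x v xv.
      pose n := (N + Ny + Nu + Nv)%N; exists (c n x); split.
      - by have := cgt n x; rewrite /n; lia.
      - by apply/asboolP; exists n.
      - move=> b; rewrite !inE => /or3P[] /eqP ->; apply/negP => /asboolP[m /esym].
        + by apply: yP; rewrite /n; lia.
        + by apply: uP; rewrite /n; lia.
        + by apply: vP; rewrite /n; lia.
    rewrite !big_cons big_nil /= /P /Q !rmorphM /= -!den -E; ring.
  move=> /eqP; rewrite /P !mulf_eq0 !denq_eq0 !orbF numq_eq0 => /eqP; exact.
Qed.

(** * The perturbed metric *)

Lemma Met_compare {R : realType} {X : topologicalType} (d e : X -> X -> R) (x : X) (r : R) :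
  Met d -> Met e -> 0 < r ->
  exists s, 0 < s /\ forall y, d x y < s -> e x y < r.
Proof.
move=> [_ gen] Me r0; have [[_ [e0 _]] _] := Me.
have [|s [s0 sP]] := proj1 (gen _) (metric_ball_open e x r Me) x.
  by rewrite /= (proj2 (e0 x x)).
by exists s; split.
Qed.

Lemma generates_topology_equiv {R : realType} {X : topologicalType} (d e : X -> X -> R) :
  generates_topology d ->
  (forall x r, 0 < r -> exists s, 0 < s /\ forall y, d x y < s -> e x y < r) ->
  (forall x r, 0 < r -> exists s, 0 < s /\ forall y, e x y < s -> d x y < r) ->
  generates_topology e.
Proof.
move=> gen de ed A; rewrite (gen A); split=> H x /H[r [r0 rA]].
  by have [s [s0 sP]] := ed x r r0; exists s; split=> // y /sP; apply: rA.
by have [s [s0 sP]] := de x r r0; exists s; split=> // y /sP; apply: rA.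
Qed.

(** Provides a compatible metric dominating both [d] and a given complete metric. *)
Lemma Met_add {R : realType} {X : topologicalType} (d e : X -> X -> R) :
  Met d -> Met e -> Met (fun x y => d x y + e x y).
Proof.
move=> Md Me; have [[dge0 [d0 [dsym dtri]]] dgen] := Md.
have [[ege0 [e0 [esym etri]]] _] := Me.
split; first (split; [|split; [|split]]).
- by move=> x y; rewrite addr_ge0.
- move=> x y; split=> [|->]; last by rewrite (proj2 (d0 y y)) // (proj2 (e0 y y)) // addr0.
  by move=> E; apply/d0; have := dge0 x y; have := ege0 x y; lra.
- by move=> x y; rewrite dsym esym.
- by move=> x y z; have := dtri x y z; have := etri x y z; lra.
apply: (generates_topology_equiv d) => // x r r0; last first.
  by exists r; split=> // y; have := ege0 x y; lra.
have r2 : 0 < r / 2 by rewrite divr_gt0.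
have [s [s0 sP]] := Met_compare d e x (r / 2) Md Me r2.
exists (Num.min s (r / 2)); rewrite lt_min s0 r2; split=> // y.
rewrite lt_min => /andP[/sP es ds]; lra.
Qed.

(** Round up to multiples of a rational step below [eps]: the ceiling is monotone and subadditive,
    so triangle inequalities survive. *)
Lemma rational_rounding {R : realType} (eps : R) : 0 < eps ->
  exists q : R -> rat,
    [/\ q 0 = 0, forall t, t <= ratr (q t) <= t + eps &
        forall a b c, c <= a + b -> q c <= q a + q b].
Proof.
move=> e0; have /rat_in_itvoo[k] := e0.
rewrite in_itv /= => /andP[k0 ke].
exists (fun t => k * (Num.ceil (t / ratr k))%:~R); split.
- by rewrite mul0r ceil0 mulr0.
- move=> t; rewrite rmorphM /= ratr_int mulrC -ler_pdivrMr // ceil_ge /=.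
  have lt1 := ltW (gt_pred_ceil (t / ratr k)).
  apply: (@le_trans _ _ ((t / ratr k + 1) * ratr k)).
    by rewrite ler_pM2r // -lerBlDr -[X in _ - X]/(1%:~R) -intrB.
  by rewrite mulrDl mul1r mulfVK ?gt_eqF // lerD2l ltW.
- move=> a b c cab; have k0' : 0 < k by rewrite -(ltr0q R).
  rewrite -mulrDr ler_pM2l // -intrD ler_int.
  apply: (@le_trans _ _ (Num.ceil (a / ratr k + b / ratr k))).
    by apply: le_ceil; rewrite -mulrDl ler_pM2r // invr_gt0.
  by rewrite ceil_le_int intrD lerD // ceil_ge.
Qed.

(** Replacing [w] by [t] leaves the excess [t * (a - b)], at most [2 * s] and hence at most
    [s * (a + b)]. *)
Lemma twisted_triangle {R : realType} (s t w a b c : R) :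
  0 <= s <= t -> t <= 1 -> w <= t -> 1 <= a -> 1 <= b -> 1 <= c -> a - b <= 2 * s ->
  w * (a + c) <= s * (a + b) + t * (b + c).
Proof.
move=> /andP[s0 st] t1 wt a1 b1 c1 ab.
have h1 : w * (a + c) <= t * (a + c) by rewrite ler_wpM2r //; lra.
have h2 : t * (a - b) <= t * (2 * s) by rewrite ler_wpM2l //; lra.
have h3 : t * (2 * s) <= 2 * s by rewrite ler_piMl //; lra.
have h4 : s * 2 <= s * (a + b) by rewrite ler_wpM2l //; lra.
lra.
Qed.

(** The last conclusion transfers Cauchy sequences from [e] to [D]: a small [e x y] forces a common
    value of [rho n], hence [D x y < 2 * rad n]. *)
Lemma LI_approximation {R : realType} {X : topologicalType} (d D : X -> X -> R) (eps : R) :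
  @strongly_zero_dim X -> @card_le_continuum R X ->
  Met d -> Met D -> (forall x y, d x y <= D x y) -> 0 < eps ->
  exists e : X -> X -> R,
    [/\ LI e, sup_dist_le d e eps &
        forall r, 0 < r -> exists s, 0 < s /\ forall x y, e x y < s -> D x y < r].
Proof.
move=> dim0 [f finj] Md MD dD eps0.
have [[dge0 [d0 [dsym dtri]]] _] := Md.
have [[Dge0 [D0 [Dsym Dtri]]] Dgen] := MD.
have Dxx x : D x x = 0 by apply/D0.
(* The error budget is three times [eps / 3]: moving both points by [rho 0], rounding, and the
   twist. *)
pose rad n : R := Num.min (eps / 6) (n.+1%:R^-1).
have rad0 n : 0 < rad n by rewrite lt_min divr_gt0 ?ltr0n // invr_gt0 ltr0n.
have radlim r : 0 < r -> exists n, rad n < r.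
  move=> /ltr_add_invr[n]; rewrite add0r => nr; exists n.
  by rewrite gt_min nr orbT.
have rad_eps n : rad n <= eps / 6 by rewrite ge_min lexx.
have /choice[rho rhoP] : forall n, exists rho : X -> X,
    (forall x, exists s, 0 < s /\ forall y, D x y < s -> rho y = rho x) /\
    (forall x, D x (rho x) < rad n).
  by move=> n; apply: locally_constant_approx.
clearbody rad.
have close n x y : rho n x = rho n y -> D x y < 2 * rad n.
  move=> E; have := Dtri x (rho n x) y; have := (rhoP n).2 x.
  by have := (rhoP n).2 y; rewrite -E (Dsym y); lra.
have sep x y : (forall n, rho n x = rho n y) -> x = y.
  move=> E; apply/D0/eqP; apply: contraT => D1.
  have Dgt : 0 < D x y / 2 by rewrite divr_gt0 // lt_def D1 Dge0.
  by have [n nr] := radlim _ Dgt; have := close n x y (E n); lra.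
have [u [u0 usym ultra uval ulev]] := ultrametric_of_levels rho sep.
have [psi [psib psiL psiI]] := independent_lipschitz rho f finj sep.
have [q [q0 qb qtri]] : exists q : R -> rat,
    [/\ q 0 = 0, forall t, t <= ratr (q t) <= t + eps / 3 &
        forall a b c, c <= a + b -> q c <= q a + q b].
  by apply: rational_rounding; rewrite divr_gt0.
(* The twist [v] is at most 8, so [eta * v] costs at most [eps / 3]. *)
have [eta [eta0 eta1]] : exists eta : rat, 0 < (ratr eta : R) /\ ratr eta < eps / 24.
  have /rat_in_itvoo[k] : 0 < eps / 24 by rewrite divr_gt0.
  by rewrite in_itv /= => /andP[k0 k1]; exists k.
pose U x y : R := ratr (u x y).
have p2R n : ratr (2 ^- n) = 2 ^- n :> R.
  by rewrite fmorphV /= rmorphXn /= ratr_nat.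
have U0 x y : U x y = 0 <-> x = y.
  by rewrite -u0 /U; split=> [/eqP|->]; rewrite ?fmorph_eq0 ?rmorph0 // => /eqP.
have Uge0 x y : 0 <= U x y.
  by rewrite /U ler0q; have [->|[n ->]] := uval x y; rewrite ?invr_ge0 ?exprn_ge0.
have Ulev n x y : U x y <= 2 ^- n <-> agree rho n x y.
  by rewrite -ulev /U -p2R ler_rat.
have U1 x y : U x y <= 1.
  by have [_] := Ulev 0%N x y; rewrite expr0 invr1; apply.
have Ultra x y z : U x z <= U x y \/ U x z <= U y z.
  by apply/orP; rewrite /U !ler_rat -le_max.
have psiU x y : psi x - psi y <= 2 * U x y.
  have [/u0 ->|[n E]] := uval x y; first by rewrite subrr mulr_ge0.
  rewrite /U E p2R (le_trans (ler_norm _)) //; apply: psiL.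
  by apply/ulev; rewrite E.
pose Q x y := q (d (rho 0%N x) (rho 0%N y)).
pose v x y : R := U x y * ((1 + psi x) + (1 + psi y)).
pose e x y : R := ratr (Q x y) + ratr eta * v x y.
have Usym x y : U x y = U y x by rewrite /U usym.
have Qge0 x y : 0 <= (ratr (Q x y) : R).
  by have /andP[+ _] := qb (d (rho 0%N x) (rho 0%N y)); apply: le_trans; apply: dge0.
have vU x y : 2 * U x y <= v x y <= 8 * U x y.
  have /andP[a1 a2] := psib x; have /andP[b1 b2] := psib y.
  rewrite /v !(mulrC _ (U x y)); apply/andP; split; apply: ler_wpM2l => //; lra.
have vtri x y z : v x z <= v x y + v y z.
  rewrite /v.
  have /andP[a1 _] := psib x; have /andP[b1 _] := psib y; have /andP[c1 _] := psib z.
  (* The larger side must play [t]; the second case reads the triangle from [z] to [x]. *)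
  have [le|/ltW le] := leP (U x y) (U y z).
    apply: twisted_triangle; rewrite ?Uge0 ?le ?U1 //; try lra.
    - by have [xz|] := Ultra x y z; [exact: le_trans le|].
    - by have := psiU x y; lra.
  rewrite [_ + (1 + psi z)]addrC [leRHS]addrC.
  rewrite (addrC (1 + psi y) (1 + psi z)) (addrC (1 + psi x) (1 + psi y)).
  apply: twisted_triangle; rewrite ?Uge0 ?le ?U1 //; try lra.
  - by have [|xz] := Ultra x y z; [|exact: le_trans le].
  - by have := psiU z y; rewrite (Usym z y); lra.
have ege x y : ratr eta * (2 * U x y) <= e x y.
  rewrite /e -[leLHS]add0r lerD // ler_pM2l //; by have /andP[] := vU x y.
have emetric : is_metric e.
  split; [|split; [|split]].
  - move=> x y; apply: le_trans (ege x y).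
    apply: mulr_ge0; [exact: ltW|exact: mulr_ge0].
  - move=> x y; split=> [E|->].
      apply/U0/eqP; rewrite eq_le Uge0 andbT -(pmulr_rle0 _ eta0) //.
      by have := ege x y; rewrite E; lra.
    by rewrite /e /v (proj2 (U0 y y)) // mul0r mulr0 addr0 /Q (proj2 (d0 _ _)) // q0 rmorph0.
  - by move=> x y; rewrite /e /v /Q dsym Usym (addrC (1 + psi x)).
  - move=> x y z; rewrite /e addrACA -mulrDr lerD ?ler_pM2l //.
    by rewrite -rmorphD ler_rat; apply: qtri; apply: dtri.
have unif r : 0 < r -> exists s, 0 < s /\ forall x y, e x y < s -> D x y < r.
  move=> r0; have [|n nr] := radlim (r / 2); first by rewrite divr_gt0.
  have p0 : 0 < 2 ^- n.+1 :> R by rewrite invr_gt0 exprn_gt0.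
  exists (ratr eta * (2 * 2 ^- n.+1)); split; first by apply: mulr_gt0 => //; apply: mulr_gt0.
  move=> x y exy; have := le_lt_trans (ege x y) exy.
  rewrite ltr_pM2l // ltr_pM2l // => /ltW/Ulev ag.
  by have := close n x y (ag n (ltnSn n)); lra.
have MetE : Met e.
  split=> //; apply: (generates_topology_equiv D) => // x r r0; last first.
    by have [s [s0 sP]] := unif r r0; exists s; split=> // y /sP.
  have [n nr] : exists n, 0 + n.+1%:R^-1 < r / (8 * ratr eta).
    by apply: ltr_add_invr; apply: divr_gt0 => //; apply: mulr_gt0.
  (* Near [x] the levels 0 to [n] are constant: level 0 kills the rounded part, and together they
     bound [U]. *)
  have [|s [s0 sP]] := @common_radius R X D x (fun m y => rho m x = rho m y) n.+1.
    by move=> m _; have [s [s0 sP]] := (rhoP m).1 x; exists s; split=> // y /sP.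
  exists s; split=> // y /sP ag.
  have Uy : U x y <= 2 ^- n.+1 by apply/Ulev.
  have p2n : 2 ^- n.+1 <= n.+1%:R^-1 :> R.
    by rewrite lef_pV2 ?posrE ?exprn_gt0 ?ltr0n // -natrX ler_nat ltnW // ltn_expl.
  rewrite /e /Q ag // (proj2 (d0 _ _)) // q0 rmorph0 add0r.
  have /andP[_ v8] := vU x y.
  apply: (@le_lt_trans _ _ (n.+1%:R^-1 * (8 * ratr eta))).
    rewrite mulrC mulrA ler_pM2r // (le_trans v8) // mulrC ler_pM2r //.
    exact: le_trans Uy p2n.
  rewrite add0r in nr.
  by rewrite -ltr_pdivlMr //; apply: mulr_gt0.
(* With the rational terms moved to the right, [psi x] has coefficient [p * eta * u x y], where only
   [p] can vanish. *)
have indep x y x' y' p p' : x <> y -> x <> x' -> x <> y' ->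
    ratr p * e x y + ratr p' * e x' y' = 0 -> p = 0.
  move=> xy xx' xy' E.
  have : p * eta * u x y = 0.
    apply: (psiI x y x' y' _ (p' * eta * u x' y')
      (- (p * (Q x y + 2 * eta * u x y) + p' * (Q x' y' + 2 * eta * u x' y')))) => //.
    move: E; rewrite /e /v /U !(rmorphM, rmorphD, rmorphN, rmorph1) /=; lra.
  move/eqP; rewrite !mulf_eq0 => /orP[/orP[/eqP //|/eqP eta_0]|/eqP/u0 //].
  by move: eta0; rewrite eta_0 rmorph0 ltxx.
exists e; split=> //; last first.
  move=> x y; have := vU x y; have := U1 x y; have := Uge0 x y.
  have := qb (d (rho 0%N x) (rho 0%N y)).
  have hx := (rhoP 0%N).2 x; have hy := (rhoP 0%N).2 y.
  have r6 := rad_eps 0%N.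
  have t1 := dtri x (rho 0%N x) y; have t2 := dtri (rho 0%N x) (rho 0%N y) y.
  have t3 := dtri (rho 0%N x) x (rho 0%N y); have t4 := dtri x y (rho 0%N y).
  have s1 := dsym (rho 0%N x) x; have s2 := dsym (rho 0%N y) y.
  have dx := dD x (rho 0%N x); have dy := dD y (rho 0%N y).
  move=> /andP[b1 b2] z0 z1 /andP[v1 v2].
  have w0 : 0 <= ratr eta * v x y by apply: mulr_ge0; [exact: ltW|lra].
  have w1 : ratr eta * v x y <= eps / 24 * 8.
    by apply: ler_pM; [exact: ltW|lra|exact: ltW|lra].
  rewrite /e /Q ler_norml; apply/andP; split; lra.
split=> // x y x' y' xy xy' ne p p' E.
have epos a b : a <> b -> 0 < e a b.
  by move=> ab; rewrite lt_def (proj1 emetric) andbT; apply/eqP => /(proj1 (proj2 emetric)).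
have zero a b (c : rat) : a <> b -> ratr c * e a b = 0 -> c = 0.
  move=> ab /eqP; rewrite mulf_eq0 fmorph_eq0 => /orP[/eqP //|/eqP e_0].
  by have := epos a b ab; rewrite e_0 ltxx.
have e_sym a b : e a b = e b a by apply: (proj1 (proj2 (proj2 emetric))).
(* As the pairs differ, one of [x], [y] lies outside [{x', y'}]; by symmetry of [e] it can come
   first in [indep]. *)
have p_0 : p = 0.
  have [xx'|xx'] := pselect (x = x').
    have [yy'|yy'] := pselect (y = y'); first by case: ne; left.
    apply: (indep y x x' y' p p') => //; first by move/esym.
      by rewrite -xx' => /esym.
    by rewrite (e_sym y x).
  have [xy''|xy''] := pselect (x = y'); last exact: (indep x y x' y' p p').
  have [yx'|yx'] := pselect (y = x'); first by case: ne; right.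
  apply: (indep y x x' y' p p') => //; first by move/esym.
    by rewrite -xy'' => /esym.
  by rewrite (e_sym y x).
split=> //; apply: (zero x' y') => //.
by move: E; rewrite p_0 rmorph0 mul0r add0r.
Qed.

Theorem theorem1p1 (R : realType) (X : topologicalType) :
  @metrizable R X -> @strongly_zero_dim X -> @card_le_continuum R X ->
  (forall (d : X -> X -> R) (eps : R), Met d -> 0 < eps ->
     exists e : X -> X -> R, LI e /\ sup_dist_le d e eps) /\
  (@completely_metrizable R X ->
   forall (d : X -> X -> R) (eps : R), Met d -> 0 < eps ->
     exists e : X -> X -> R, LI e /\ complete_metric e /\ sup_dist_le d e eps).
Proof.
move=> _ dim0 card; split=> [d eps Md eps0|[c [Mc cc]] d eps Md eps0].
  have [//|e [Le de _]] := LI_approximation d d eps dim0 card Md Md _ eps0.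
  by exists e.
have [[cge0 [_ [csym _]]] _] := Mc; have [[dge0 _] _] := Md.
(* Since [c <= d + c], sequences that are Cauchy for [e] become Cauchy for [c]. *)
have [|e [Le de unif]] := LI_approximation d (fun x y => d x y + c x y) eps dim0 card Md
  (Met_add d c Md Mc) _ eps0; first by move=> x y; rewrite lerDl.
exists e; split=> //; split=> // w wC.
have [|x xP] := cc w.
  move=> r r0; have [s [s0 sP]] := unif r r0; have [N NP] := wC s s0.
  exists N => m n Nm Nn; have := sP _ _ (NP m n Nm Nn).
  by have := dge0 (w m) (w n); lra.
have Me : Met e by case: Le.
have [[_ [_ [esym _]]] _] := Me.
(* Convergence for [c] passes to [e] because both generate the same topology. *)
exists x => r r0; have [s [s0 sP]] := Met_compare c e x r Mc Me r0.
have [N NP] := xP s s0; exists N => n Nn.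
by rewrite esym; apply: sP; rewrite csym; apply: NP.
Qed.
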